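(* Let $P\subset N_{\mathbb{Q}}$ be a lattice polytope with the origin in its strict interior, and let $Q:=\mathrm{mut}_w(P,F)$ be a combinatorial mutation of $P$. Then the Ehrhart series of the dual polytopes agree: $\mathrm{Ehr}_{P^*}(t)=\mathrm{Ehr}_{Q^*}(t)$.
   Context: $N$ is a lattice of rank $n$, $N_{\mathbb{Q}}=N\otimes\mathbb{Q}$, $M=\mathrm{Hom}(N,\mathbb{Z})$, $M_{\mathbb{Q}}=M\otimes\mathbb{Q}$. Polytopes are convex; a lattice polytope has vertices in $N$; $\mathcal{V}(P)$ denotes the vertex set of $P$. Dual: $P^*=\{u\in M_{\mathbb{Q}}\mid u(v)\ge-1\text{ for all }v\in P\}$. When the origin is in the strict interior of $P$ this is a rational polytope. Ehrhart series: for a rational polytope $R\subset M_{\mathbb{Q}}$, $L_R(m)=|mR\cap M|$ and $\mathrm{Ehr}_R(t)=\sum_{m\ge0}L_R(m)t^m$. Combinatorial mutation: let $w\in M$ be a primitive lattice vector and $P\subset N_{\mathbb{Q}}$ a lattice polytope. Set $h_{\min}=\min\{w(v)\mid v\in P\}$, $h_{\max}=\max\{w(v)\mid v\in P\}$. For $h\in\mathbb{Z}$ let $H_{w,h}=\{x\in N_{\mathbb{Q}}\mid w(x)=h\}$ and $w_h(P)=\mathrm{conv}(H_{w,h}\cap P\cap N)$. Minkowski sum is $Q+R=\{q+r\mid q\in Q,r\in R\}$, with the convention $Q+\varnothing=\varnothing$. A (nonempty) lattice polytope $F\subset N_{\mathbb{Q}}$ with $w(F)=0$ is called a factor for $P$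 with respect to $w$ if for every integer $h_{\min}\le h<0$ there exists a possibly empty lattice polytope $G_h\subset N_{\mathbb{Q}}$ with $$H_{w,h}\cap\mathcal{V}(P)\subseteq G_h+(-h)F\subseteq w_h(P).$$ Given such $w$, $F$, $\{G_h\}$, the combinatorial mutation is the lattice polytope $$\mathrm{mut}_w(P,F;\{G_h\})=\mathrm{conv}\left(\bigcup_{h=h_{\min}}^{-1}G_h\cup\bigcup_{h=0}^{h_{\max}}(w_h(P)+hF)\right).$$ This is independent of the choice of $\{G_h\}$, and is written $\mathrm{mut}_w(P,F)$. *)

(* Defs.v *)
(* The rank n lattice N is Z^n, realised as the integral vectors of the space
   N_Q = 'rV[rat]_n of row vectors; its dual M = Hom(N, Z) is realised as the
   integral vectors of the space M_Q = 'cV[rat]_n of column vectors, a column u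
   acting on rows by v |-> v *m u. *)
From HB Require Import structures.
From mathcomp Require Import all_boot all_order all_algebra.
From mathcomp Require Import finmap.
From mathcomp Require Import boolp classical_sets functions cardinality.
From mathcomp Require Import topology normedtype convex.
Set Implicit Arguments.
Unset Strict Implicit.
Unset Printing Implicit Defensive.
Import Order.TTheory GRing.Theory Num.Theory.
Import numFieldNormedType.Exports.
Local Open Scope classical_set_scope.
Local Open Scope ring_scope.

Definition pairing n (u : 'cV[rat]_n) (v : 'rV[rat]_n) : rat := (v *m u) 0 0.

Definition lattice_pts m n : set 'M[rat]_(m, n) :=
  range (map_mx (intr : int -> rat)).

Definition primitive n (w : 'cV[int]_n) : Prop :=
  w != 0 /\
  forall (k : int) (w' : 'cV[int]_n), w = k *: w' -> k = 1 \/ k = -1.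

Definition height n (w : 'cV[int]_n) (v : 'rV[rat]_n) : rat :=
  pairing (map_mx intr w) v.

Section SetOperations.
Variable V : lmodType rat.
Implicit Types A B P : set V.

Definition conv A : set V := smallest (@convex_set rat V) A.

Definition minkowski_sum A B : set V := [set a + b | a in A & b in B].

Definition dilate (c : rat) A : set V := [set c *: a | a in A].

(* Vertices are the extreme points; P is meant to be a polytope. *)
Definition vertices P : set V :=
  [set v | P v /\ forall (x y : V) (t : rat), P x -> P y -> 0 < t < 1 ->
                    v = t *: x + (1 - t) *: y -> x = y].

(* The empty set is a polytope. *)
Definition polytope P : Prop := exists2 S : set V, finite_set S & P = conv S.
End SetOperations.

Definition lattice_polytope n (P : set 'rV[rat]_n) : Prop :=
  polytope P /\ vertices P `<=` @lattice_pts 1 n.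

(* The interior for the product topology; rat^o is the copy of rat which
   carries the topology of the absolute value. *)
Definition strict_interior n (P : set 'rV[rat]_n) : set 'rV[rat]_n :=
  interior (P : set 'rV[rat^o]_n).

Definition dual n (P : set 'rV[rat]_n) : set 'cV[rat]_n :=
  [set u | forall v, P v -> -1 <= pairing u v].

(* fset_set is empty on an infinite set, so lattice_count R m is the number of
   lattice points of m R only when that number is finite. When 0 is in R (as
   for R = dual P) the default value 0 cannot be mistaken for a genuine count,
   because then 0 is a lattice point of every m R. *)
Definition lattice_count n (R : set 'cV[rat]_n) (m : nat) : nat :=
  #|` fset_set (dilate m%:R R `&` @lattice_pts n 1) |%fset.

(* A formal power series \sum_m a_m t^m is represented by its sequence of
   coefficients. *)
Definition Ehr n (R : set 'cV[rat]_n) : nat -> nat := fun m => lattice_count R m.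

Section Mutation.
Variable n : nat.
Implicit Types (w : 'cV[int]_n) (P F : set 'rV[rat]_n).
Implicit Types (G : int -> set 'rV[rat]_n).

(* The minimum and maximum of w on P (0 when they are not attained). *)
Definition hmin w P : rat :=
  xget 0 ((height w @` P) `&` lbound (height w @` P)).

Definition hmax w P : rat :=
  xget 0 ((height w @` P) `&` ubound (height w @` P)).

Definition hyperplane w (h : int) : set 'rV[rat]_n :=
  [set x | height w x = h%:~R].

(* The slice w_h(P). *)
Definition slice w P (h : int) : set 'rV[rat]_n :=
  conv (hyperplane w h `&` P `&` @lattice_pts 1 n).

(* F is a factor for P with respect to w, and this is witnessed by the
   family G, of which only the G h with hmin w P <= h < 0 matter. *)
Definition factor_witness w P F G : Prop :=
  [/\ lattice_polytope F,
      F !=set0,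
      (forall x, F x -> height w x = 0) &
      forall h : int, hmin w P <= h%:~R -> h < 0 ->
        [/\ lattice_polytope (G h),
            hyperplane w h `&` vertices P `<=`
              minkowski_sum (G h) (dilate (- h)%:~R F) &
            minkowski_sum (G h) (dilate (- h)%:~R F) `<=` slice w P h]].

Definition mut w P F G : set 'rV[rat]_n :=
  conv ((\bigcup_(h in [set h : int | hmin w P <= h%:~R /\ h < 0]) G h) `|`
        (\bigcup_(h in [set h : int | 0 <= h /\ h%:~R <= hmax w P])
           minkowski_sum (slice w P h) (dilate h%:~R F))).
End Mutation.

(* Main.v *)
(* For u in M_Q let a(u) be the minimum of u on the factor F, and consider the
   piecewise linear map phi(u) = u - a(u) w.  Since w vanishes on F,
   a(u + c w) = a(u), so phi is a bijection; a(u) is attained at a lattice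
   vertex of F when u is in M, so phi preserves M; and phi is positively
   homogeneous.  Finally phi maps P^* onto Q^*: at height h the multiples of F
   added to or removed from the slices of P change the minimum of u by h a(u),
   which is exactly what the term - a(u) w compensates.  Hence phi restricts to
   a bijection between the lattice points of m P^* and those of m Q^*. *)
Require Import Defs.
From HB Require Import structures.
From mathcomp Require Import all_boot all_order all_algebra.
From mathcomp Require Import finmap interval_inference.
From mathcomp Require Import boolp classical_sets.
From mathcomp Require Import cardinality convex(convex_set) lra.
Import Order.TTheory GRing.Theory Num.Theory.
Local Open Scope classical_set_scope.
Local Open Scope ring_scope.

(** * Counting a possibly infinite set through an injection *)

Lemma fset_set_infinite (T : choiceType) (A : set T) :
  ~ finite_set A -> fset_set A = fset0.
Proof. by move=> Ainf; rewrite /fset_set; case: pselect. Qed.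

(** An infinite set has an infinite injective image, so both counts then take the default value
    0. *)
Lemma card_fset_set_image (T U : choiceType) (f : T -> U) (A : set T) :
  injective f -> #|` fset_set (f @` A)|%fset = #|` fset_set A|%fset.
Proof.
move=> f_inj; have [finA|infA] := pselect (finite_set A).
  by rewrite fset_set_image// card_imfset.
rewrite !fset_set_infinite// => finfA; apply: infA.
have -> : A = f @^-1` (f @` A).
  by apply/seteqP; split=> [x Ax|x [y Ay /f_inj <-]//]; exists x.
by apply: finite_preimage => // x y _ _ /f_inj.
Qed.

(** * Convex hulls over the rationals *)

Section ConvexHull.
Context {V : lmodType rat}.
Implicit Types A B : set V.

Lemma convex_setP A :
  convex_set A <->
  forall x y t, 0 <= t <= 1 -> A x -> A y -> A (t *: x + (1 - t) *: y).
Proof.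
split=> [cA x y t t01 Ax Ay|cA x y t].
  case/andP: t01 => t0 t1.
  have := cA x y (Itv01 t0 t1); rewrite !inE; exact.
rewrite !inE; apply: cA; exact/andP.
Qed.

Lemma subset_conv A : A `<=` conv A.
Proof. exact: sub_gen_smallest. Qed.

Lemma conv_subset A B : convex_set B -> A `<=` B -> conv A `<=` B.
Proof. exact: smallest_sub. Qed.

Lemma convex_conv A : convex_set (conv A).
Proof.
apply/convex_setP => x y t t01 Ax Ay B [cB AB].
by move/convex_setP: (cB); apply=> //; [apply: Ax|apply: Ay].
Qed.

Lemma polytope_convex A : polytope A -> convex_set A.
Proof. by move=> [S _ ->]; exact: convex_conv. Qed.

End ConvexHull.

(** * The pairing of M and N, and duals *)

Section Pairing.
Context {n : nat}.
Implicit Types (u w : 'cV[rat]_n) (x y : 'rV[rat]_n) (c : rat).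

Lemma pairingDr u x y : pairing u (x + y) = pairing u x + pairing u y.
Proof. by rewrite /pairing mulmxDl mxE. Qed.

Lemma pairingZr u c x : pairing u (c *: x) = c * pairing u x.
Proof. by rewrite /pairing -scalemxAl mxE. Qed.

Lemma pairingNr u x : pairing u (- x) = - pairing u x.
Proof. by rewrite -scaleN1r pairingZr mulN1r. Qed.

Lemma pairingDl u w x : pairing (u + w) x = pairing u x + pairing w x.
Proof. by rewrite /pairing mulmxDr mxE. Qed.

Lemma pairingZl c u x : pairing (c *: u) x = c * pairing u x.
Proof. by rewrite /pairing -scalemxAr mxE. Qed.

Lemma pairingNl u x : pairing (- u) x = - pairing u x.
Proof. by rewrite -scaleN1r pairingZl mulN1r. Qed.

Lemma pairing_delta (i : 'I_n) x : pairing (delta_mx i 0) x = x 0 i.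
Proof. by rewrite /pairing -colE mxE. Qed.

Lemma pairing_lattice u x :
  @lattice_pts n 1 u -> @lattice_pts 1 n x ->
  exists k : int, pairing u x = k%:~R.
Proof.
move=> [u' _ <-] [x' _ <-]; exists ((x' *m u') 0 0).
by rewrite /pairing -map_mxM mxE.
Qed.

Lemma convex_pairing_ge u c : convex_set [set x | c <= pairing u x].
Proof.
apply/convex_setP => x y t /andP[t0 t1] /= cx cy.
rewrite pairingDr !pairingZr; nra.
Qed.

Lemma convex_pairing_eq u c : convex_set [set x | pairing u x = c].
Proof.
apply/convex_setP => x y t _ /= cx cy.
by rewrite pairingDr !pairingZr cx cy -mulrDl addrC subrK mul1r.
Qed.

(** Each condition [-1 <= pairing u x] cuts out a convex half-space in [x]. Thus the dual of a
    mutation can be tested on the generators of its hull. *)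
Lemma dual_conv (A : set 'rV[rat]_n) : dual (conv A) = dual A.
Proof.
apply/seteqP; split=> u uA x Ax; first by apply: uA; exact: subset_conv.
exact: (conv_subset _ _ (convex_pairing_ge u (- 1)) uA _ Ax).
Qed.

End Pairing.

(** * Lexicographic comparison by a list of functionals *)

Section LexicographicOrder.
Context {n : nat}.
Implicit Types (us : seq 'cV[rat]_n) (x y : 'rV[rat]_n).

(** The cone of nonnegative vectors of a total preorder: [lex_ge0 us (x - v)] says that [v] comes no
    later than [x]. *)
Fixpoint lex_ge0 us x : bool :=
  if us is u :: us' then
    (0 < pairing u x) || (pairing u x == 0) && lex_ge0 us' x
  else true.

Lemma lex_ge0D us x y : lex_ge0 us x -> lex_ge0 us y -> lex_ge0 us (x + y).
Proof.
elim: us => //= u us IH; rewrite pairingDr.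
case/orP=> [x0|/andP[/eqP -> lx]] /orP[y0|/andP[/eqP -> ly]].
- by rewrite addr_gt0.
- by rewrite addr0 x0.
- by rewrite add0r y0.
- by rewrite addr0 eqxx IH ?orbT.
Qed.

Lemma lex_ge00 us : lex_ge0 us 0.
Proof.
by elim: us => //= u us ->; rewrite -(scale0r 0) pairingZr mul0r eqxx orbT.
Qed.

Lemma lex_ge0Z us c x : 0 <= c -> lex_ge0 us x -> lex_ge0 us (c *: x).
Proof.
rewrite le_eqVlt => /predU1P[<-|c0].
  by rewrite scale0r lex_ge00.
elim: us => //= u us IH; rewrite pairingZr pmulr_rgt0// mulf_eq0.
rewrite (gt_eqF c0) /=.
by move=> /orP[->|/andP[-> /IH ->]]; rewrite ?orbT.
Qed.

Lemma lex_ge0_total us x : lex_ge0 us x || lex_ge0 us (- x).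
Proof.
elim: us => //= u us; rewrite pairingNr oppr_gt0 oppr_eq0.
by case: ltgtP.
Qed.

(** Once [us] contains all coordinate functionals, this makes the preorder antisymmetric. *)
Lemma lex_ge0_anti us x u :
  lex_ge0 us x -> lex_ge0 us (- x) -> u \in us -> pairing u x = 0.
Proof.
elim: us => //= v us IH; rewrite pairingNr oppr_gt0 oppr_eq0.
case: ltgtP => //= v0 lx lNx; rewrite inE => /predU1P[->//|].
exact: IH.
Qed.

Lemma lex_min us (s : seq 'rV[rat]_n) : s != [::] ->
  exists2 v, v \in s & forall x, x \in s -> lex_ge0 us (x - v).
Proof.
elim: s => // x [|y s] IH _.
  by exists x; rewrite ?mem_head// => z /[!inE] /eqP ->; rewrite subrr lex_ge00.
have [//|v vs vmin] := IH.
have [xv|xv] := orP (lex_ge0_total us (x - v)).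
  exists v => [|z]; first by rewrite in_cons vs orbT.
  by rewrite in_cons => /predU1P[->|/vmin].
exists x; rewrite ?mem_head// => z; rewrite in_cons => /predU1P[->|/vmin vz].
  by rewrite subrr lex_ge00.
by rewrite -(subrKA v) -[v - x]opprB lex_ge0D.
Qed.

End LexicographicOrder.

(** * Linear functionals attain their minimum at a vertex *)

Section MinimumOnPolytope.
Context {n : nat}.
Implicit Types (P F : set 'rV[rat]_n) (u w : 'cV[rat]_n).

(* The lexicographic order starting with u and refined by the coordinates is
   total, so its minimum on a finite generating set is an extreme point. *)
Lemma polytope_min_vertex P u : polytope P -> P !=set0 ->
  exists2 v, vertices P v & forall x, P x -> pairing u v <= pairing u x.
Proof.
move=> [S /finite_seqP[s ->] ->] [x0 Px0].
have s_neq0 : s != [::].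
  apply/eqP => s0; apply: (@conv_subset _ _ set0 _ _ x0 Px0).
    by apply/convex_setP.
  by move=> x /=; rewrite s0.
pose us := u :: [seq delta_mx i 0 | i <- enum 'I_n].
have [v vs vmin] := lex_min us _ s_neq0.
(* The vectors that [v] precedes form a convex set, so the minimum over the generators is the
   minimum over the hull. *)
have vminP x : conv [set` s] x -> lex_ge0 us (x - v).
  apply: (@conv_subset _ _ [set x | lex_ge0 us (x - v)]) => [|y /vmin//].
  apply/convex_setP => y z t /andP[t0 t1]; rewrite /mkset => yv zv.
  have -> : t *: y + (1 - t) *: z - v = t *: (y - v) + (1 - t) *: (z - v).
    rewrite !scalerBr addrACA -opprD -scalerDl.
    by rewrite [t + _]addrC subrK scale1r.
  by apply: (lex_ge0D us); apply: lex_ge0Z; rewrite ?subr_ge0.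
exists v; last first.
  move=> x /vminP /= /orP[|/andP[]]; rewrite pairingDr pairingNr.
    by rewrite subr_gt0 => /ltW.
  by rewrite subr_eq0 => /eqP ->.
split=> [|x y t Px Py /andP[t0 t1] vE]; first exact: subset_conv.
have t1' : 0 < 1 - t by rewrite subr_gt0.
have comb0 : t *: (x - v) + (1 - t) *: (y - v) = 0.
  rewrite !scalerBr addrACA -opprD -scalerDl -vE.
  by rewrite [t + _]addrC subrK scale1r subrr.
(* The opposite of [z - v] is a positive multiple of [z' - v], so both signs of [z - v] are
   nonnegative and antisymmetry forces [z = v]. *)
have eqv z r z' r' : 0 < r -> 0 < r' ->
    lex_ge0 us (z - v) -> lex_ge0 us (z' - v) ->
    r *: (z - v) + r' *: (z' - v) = 0 -> z = v.
  move=> r0 r'0 lz lz' /eqP; rewrite addr_eq0 => /eqP zE.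
  have lN : lex_ge0 us (- (z - v)).
    have -> : - (z - v) = r^-1 *: (r' *: (z' - v)).
      by rewrite -[r' *: _]opprK -zE scalerN scalerA mulVf ?gt_eqF// scale1r.
    by rewrite !lex_ge0Z// ?invr_ge0 ltW.
  apply/rowP => i; apply/eqP; rewrite -subr_eq0; apply/eqP.
  have /(lex_ge0_anti _ _ _ lz lN) : delta_mx i 0 \in us.
    by rewrite in_cons (map_f (fun i => delta_mx i 0)) ?orbT ?mem_enum.
  by rewrite pairing_delta !mxE.
rewrite (eqv x t y (1 - t))//; [|exact: vminP|exact: vminP].
by rewrite (eqv y (1 - t) x t)//; [exact: vminP|exact: vminP|rewrite addrC].
Qed.

(** The number a(u). It has the shape of [hmin], which is thereby convertible to the minimum of [w]
    on [P]. *)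
Definition min_on F u : rat :=
  xget 0 ((pairing u @` F) `&` lbound (pairing u @` F)).

Lemma min_on_eq F u v : F v ->
  (forall x, F x -> pairing u v <= pairing u x) -> min_on F u = pairing u v.
Proof.
move=> Fv vmin; rewrite /min_on; case: xgetP => [c _ [[x Fx <-] xmin]|none].
  by apply/eqP; rewrite eq_le vmin// andbT; apply: xmin; exists v.
case: (none (pairing u v)); split; first by exists v.
by move=> _ [x Fx <-]; exact: vmin.
Qed.

Lemma min_on_vertex F u : polytope F -> F !=set0 ->
  exists2 v, vertices F v & min_on F u = pairing u v.
Proof.
move=> pF F0; have [v vF vmin] := polytope_min_vertex F u pF F0.
by exists v => //; apply: min_on_eq => //; case: vF.
Qed.

Lemma min_on_le F u x : polytope F -> F x -> min_on F u <= pairing u x.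
Proof.
move=> pF Fx; have [|v [Fv _] vmin] := polytope_min_vertex F u pF.
  by exists x.
by rewrite (min_on_eq _ _ _ Fv vmin) vmin.
Qed.

Lemma min_onZ F u c : polytope F -> F !=set0 -> 0 <= c ->
  min_on F (c *: u) = c * min_on F u.
Proof.
move=> pF F0 c0; have [v [Fv _] vE] := min_on_vertex F u pF F0.
rewrite (min_on_eq _ _ v)// ?pairingZl ?vE// => x Fx.
by rewrite !pairingZl ler_wpM2l// -vE min_on_le.
Qed.

Lemma min_on_shift F u w c : polytope F -> F !=set0 ->
  (forall x, F x -> pairing w x = 0) -> min_on F (u + c *: w) = min_on F u.
Proof.
move=> pF F0 wF; have [v [Fv _] vE] := min_on_vertex F u pF F0.
have shiftE x : F x -> pairing (u + c *: w) x = pairing u x.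
  by move=> Fx; rewrite pairingDl pairingZl wF// mulr0 addr0.
rewrite (min_on_eq _ _ v)// ?shiftE// => x Fx.
by rewrite shiftE// -vE min_on_le.
Qed.

Lemma min_on_lattice F u : lattice_polytope F -> F !=set0 ->
  @lattice_pts n 1 u -> exists k : int, min_on F u = k%:~R.
Proof.
move=> [pF latF] F0 latu; have [v /latF latv ->] := min_on_vertex F u pF F0.
exact: pairing_lattice.
Qed.

End MinimumOnPolytope.

(** * Height bounds and slices *)

Section Height.
Context {n : nat}.
Implicit Types (w : 'cV[int]_n) (P : set 'rV[rat]_n) (x : 'rV[rat]_n).

Lemma hmin_le w P x : polytope P -> P x -> hmin w P <= height w x.
Proof. exact: min_on_le. Qed.

Lemma le_hmax w P x : polytope P -> P x -> height w x <= hmax w P.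
Proof.
move=> pP Px.
(* A maximum of [w] is a minimum of its opposite. *)
have [|v [Pv _] vmax] := polytope_min_vertex P (- map_mx intr w) pP.
  by exists x.
rewrite /hmax; case: xgetP => [c _ [_ +]|none]; first by apply; exists x.
case: (none (height w v)); split; first by exists v.
by move=> _ [y Py <-]; rewrite -lerN2 /height -!pairingNl vmax.
Qed.

Lemma slice_sub w P h : convex_set P -> slice w P h `<=` P.
Proof. by move=> cP; apply: conv_subset => // x [[]]. Qed.

Lemma slice_height w P h x : slice w P h x -> height w x = h%:~R.
Proof.
apply: (@conv_subset _ _ [set x | height w x = h%:~R]) => [|y [[]]//].
exact: convex_pairing_eq.
Qed.

End Height.

(** * The piecewise linear bijection between the duals *)

Section DualMutation.
Context {n : nat}.
Variables (w : 'cV[int]_n) (P F : set 'rV[rat]_n) (G : int -> set 'rV[rat]_n).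
Hypotheses (latP : lattice_polytope P) (fwG : factor_witness w P F G).
Implicit Types (u : 'cV[rat]_n) (x : 'rV[rat]_n).

Let wQ : 'cV[rat]_n := map_mx intr w.
Let pP : polytope P := latP.1.
Let pF : polytope F. Proof. by case: fwG => -[]. Qed.
Let F0 : F !=set0. Proof. by case: fwG. Qed.
Let wF x : F x -> pairing wQ x = 0. Proof. by case: fwG => _ _ + _; apply. Qed.

Definition dual_mut_map u : 'cV[rat]_n := u - min_on F u *: wQ.

Definition dual_mut_inv u : 'cV[rat]_n := u + min_on F u *: wQ.

Lemma dual_mut_mapK : cancel dual_mut_map dual_mut_inv.
Proof.
move=> u; rewrite /dual_mut_inv /dual_mut_map -scaleNr min_on_shift//.
by rewrite scaleNr subrK.
Qed.

Lemma dual_mut_invK : cancel dual_mut_inv dual_mut_map.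
Proof.
by move=> u; rewrite /dual_mut_inv /dual_mut_map min_on_shift// addrK.
Qed.

Lemma dual_mut_mapZ c u : 0 <= c ->
  dual_mut_map (c *: u) = c *: dual_mut_map u.
Proof. by move=> c0; rewrite /dual_mut_map min_onZ// scalerBr scalerA. Qed.

Lemma lattice_pts_shift u (k : int) :
  @lattice_pts n 1 u -> @lattice_pts n 1 (u + k%:~R *: wQ).
Proof.
by move=> [u' _ <-]; exists (u' + k *: w) => //; rewrite map_mxD map_mxZ.
Qed.

Lemma dual_mut_map_lattice u :
  @lattice_pts n 1 u -> @lattice_pts n 1 (dual_mut_map u).
Proof.
case: fwG => latF _ _ _ latu; have [k kE] := min_on_lattice F u latF F0 latu.
by rewrite /dual_mut_map kE -scaleNr -mulrNz; exact: lattice_pts_shift.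
Qed.

Lemma dual_mut_inv_lattice u :
  @lattice_pts n 1 u -> @lattice_pts n 1 (dual_mut_inv u).
Proof.
case: fwG => latF _ _ _ latu; have [k kE] := min_on_lattice F u latF F0 latu.
by rewrite /dual_mut_inv kE; exact: lattice_pts_shift.
Qed.

Lemma pairing_dual_mut_map u x :
  pairing (dual_mut_map u) x = pairing u x - min_on F u * height w x.
Proof. by rewrite pairingDl pairingNl pairingZl. Qed.

Lemma dual_mut_map_dual u :
  dual P u -> dual (mut w P F G) (dual_mut_map u).
Proof.
move=> uP; rewrite /mut dual_conv => x Qx; rewrite pairing_dual_mut_map.
have [f [Ff _] fE] := min_on_vertex F u pF F0.
have cP := polytope_convex _ pP.
case: Qx => [[h [hmin_h h0] Ghx]|[h [h0 _] [s sl [_ [g Fg <-] <-]]]].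
  case: fwG => _ _ _ /(_ h hmin_h h0)[_ _ GF].
  (* Adding [-h] times a minimiser [f] of [u] on [F] moves [x] into a slice of [P], and the value of
     [u] there is [pairing u x - h * min_on F u], which is the value of the new functional at
     [x]. *)
  have /GF sl : minkowski_sum (G h) (dilate (- h)%:~R F) (x + (- h)%:~R *: f).
    by exists x => //; exists ((- h)%:~R *: f) => //; exists f.
  have := uP _ (slice_sub _ _ _ cP _ sl); have := slice_height _ _ _ _ sl.
  rewrite /height !pairingDr !pairingZr (wF _ Ff) mulr0 addr0 => ->.
  by rewrite fE mulrNz mulNr mulrC.
(* Here [x = s + h g] with [h >= 0]; since [u] is at least [min_on F u] at [g], the new functional
   at [x] is at least [u] at [s]. *)
have := uP _ (slice_sub _ _ _ cP _ sl); have := slice_height _ _ _ _ sl.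
rewrite /height !pairingDr !pairingZr (wF _ Fg) mulr0 addr0 => ->.
have : 0 <= h%:~R :> rat by rewrite ler0z.
have := min_on_le _ u _ pF Fg; nra.
Qed.

(** It suffices to bound [u] at a vertex of [P] minimising it, and vertices are what the left
    inclusion of the factor condition controls. *)
Lemma dual_dual_mut_map u :
  dual (mut w P F G) (dual_mut_map u) -> dual P u.
Proof.
move=> uQ x Px.
have [|v vP vmin] := polytope_min_vertex P u pP; first by exists x.
apply: le_trans (vmin _ Px) => {x Px vmin}.
have Pv : P v by case: vP.
have latv : @lattice_pts 1 n v by exact: latP.2.
(* The vertex is a lattice point, so its height is an integer and selects a slice. *)
have [|h vh] := pairing_lattice wQ v _ latv; first by exists w.
move: uQ; rewrite /mut dual_conv => uQ.
have [h0|h0] := ltP h 0.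
  have hmin_h : hmin w P <= h%:~R by rewrite -vh; exact: hmin_le.
  case: fwG => _ _ _ /(_ h hmin_h h0)[_ + _].
  (* Write [v = g + (-h) f]. As [-h > 0] and [u] is at least [min_on F u] at [f], the value of [u]
     at [v] is at least that of the new functional at [g]. *)
  move=> /(_ v (conj vh vP))[g Gg [_ [f Ff <-] gfE]].
  have := uQ g (or_introl (ex_intro2 _ _ h (conj hmin_h h0) Gg)).
  have : height w g = h%:~R.
    have := vh; rewrite -gfE pairingDr pairingZr (wF _ Ff).
    by rewrite mulr0 addr0.
  rewrite pairing_dual_mut_map -gfE pairingDr pairingZr mulrNz => ->.
  have : h%:~R < 0 :> rat by rewrite ltrz0.
  have := min_on_le _ u _ pF Ff; nra.
have [f [Ff _] fE] := min_on_vertex F u pF F0.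
have hmax_h : h%:~R <= hmax w P by rewrite -vh; exact: le_hmax.
have sl : slice w P h v by apply: subset_conv.
(* With [f] a minimiser, the two terms [h * min_on F u] cancel, and the new functional at this
   generator equals [u] at [v]. *)
have := uQ (v + h%:~R *: f); rewrite pairing_dual_mut_map /height !pairingDr.
rewrite !pairingZr vh (wF _ Ff) mulr0 addr0 fE mulrC addrK; apply.
by right; exists h => //; exists v => //; exists (h%:~R *: f) => //; exists f.
Qed.

Lemma dilate_dual_mut m :
  dilate m%:R (dual (mut w P F G)) `&` @lattice_pts n 1 =
  dual_mut_map @` (dilate m%:R (dual P) `&` @lattice_pts n 1).
Proof.
apply/seteqP; split=> [_ [[u uQ <-] latu]|_ [_ [[u uP <-] latu] <-]].
  exists (dual_mut_inv (m%:R *: u)); last exact: dual_mut_invK.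
  split; last exact: dual_mut_inv_lattice.
  exists (dual_mut_inv u).
    by apply: dual_dual_mut_map; rewrite dual_mut_invK.
  (* Compatibility of the inverse with dilation is reduced to that of the map itself. *)
  apply: (can_inj dual_mut_mapK).
  by rewrite dual_mut_mapZ// !dual_mut_invK.
split; last exact: dual_mut_map_lattice.
exists (dual_mut_map u); first exact: dual_mut_map_dual.
by rewrite dual_mut_mapZ.
Qed.

End DualMutation.

Theorem proposition4 (n : nat) (w : 'cV[int]_n) (P F : set 'rV[rat]_n)
    (G : int -> set 'rV[rat]_n) :
  lattice_polytope P ->
  strict_interior P 0 ->
  primitive w ->
  factor_witness w P F G ->
  Ehr (dual P) = Ehr (dual (mut w P F G)).
Proof.
move=> latP _ _ fwG; apply/funext => m.
rewrite /Ehr /lattice_count (dilate_dual_mut w P F G)// card_fset_set_image//.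
exact: can_inj (dual_mut_mapK _ _ _ _ fwG).
Qed.
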